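(* Let $B$ be an algebra and $(\Omega^1(B),\mathrm{d})$ a first-order differential calculus over $B$. Let $\nabla:\Omega^1(B)\to\Omega^1(B)\otimes_B\Omega^1(B)$ be a bimodule connection, with associated bimodule map $\sigma$, that is torsion-free with respect to the maximal prolongation $\Omega^\bullet(B)$ of $\Omega^1(B)$. Then the space $N^{(2)}$ of degree two relations of the maximal prolongation of $\Omega^1(B)$ is generated as a $B$-bimodule by $G=G_1\cup G_2$, where $$G_1:=\{\omega\otimes\nu+\sigma(\omega\otimes\nu)\mid \omega,\nu\in\Omega^1(B)\},\qquad G_2:=\{\nabla(\mathrm{d}b)\mid b\in B\}.$$
   Context: All algebras are unital and over $\mathbb{C}$. A first-order differential calculus (fodc) over $B$ is a pair $(\Omega^1(B),\mathrm{d})$ with $\Omega^1(B)$ a $B$-bimodule and $\mathrm{d}:B\to\Omega^1(B)$ a derivation such that $\Omega^1(B)$ is generated as a left $B$-module by the elements $\mathrm{d}b$, $b\in B$. A differential calculus (dc) over $B$ is a differential graded algebra $(\Omega^\bullet=\bigoplus_{k\ge 0}\Omega^k,\mathrm{d})$ with $\Omega^0=B$, generated as an algebra by the elements $a,\mathrm{d}b$ for $a,b\in B$; its product is denoted $\wedge$. A dc extends a fodc if its degree one part, with $\mathrm{d}:\Omega^0\to\Omega^1$, is isomorphic to the fodc. The maximal prolongation of $\Omega^1(B)$ is the extension $\Omega^\bullet(B)$ such that there is a unique differential map from it onto any other extension. It is of the form $\mathcal{T}_B(\Omega^1(B))/\langle N^{(2)}\rangle$ for a sub-bimodule $N^{(2)}\subseteq\Omega^1(B)\otimes_B\Omega^1(B)$;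 thus $\Omega^2(B)\simeq(\Omega^1(B)\otimes_B\Omega^1(B))/N^{(2)}$ and $N^{(2)}$ is the kernel of $\wedge:\Omega^1(B)\otimes_B\Omega^1(B)\to\Omega^2(B)$. A connection on a left $B$-module $\mathcal{F}$ is a $\mathbb{C}$-linear map $\nabla:\mathcal{F}\to\Omega^1(B)\otimes_B\mathcal{F}$ with $\nabla(bf)=\mathrm{d}b\otimes f+b\nabla(f)$. For $\mathcal F$ a $B$-bimodule, $\nabla$ is a (left) bimodule connection if there is a (necessarily unique) $B$-bimodule map $\sigma:\mathcal{F}\otimes_B\Omega^1(B)\to\Omega^1(B)\otimes_B\mathcal{F}$, the associated bimodule map, with $\nabla(fb)=\nabla(f)b+\sigma(f\otimes\mathrm{d}b)$ for all $f\in\mathcal F$, $b\in B$. For $\mathcal{F}=\Omega^1(B)$ the torsion is $T_\nabla:=\wedge\circ\nabla-\mathrm{d}:\Omega^1(B)\to\Omega^2(B)$, and $\nabla$ is torsion-free if $T_\nabla=0$. *)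

(* Defs.v *)
From HB Require Import structures.
From mathcomp Require Import all_boot all_algebra.
From mathcomp Require Import generic_quotient ring_quotient.
From mathcomp Require Import boolp classical_sets.
From mathcomp.multinomials Require Import freeg.

Set Implicit Arguments.
Unset Strict Implicit.
Unset Printing Implicit Defensive.

Import GRing.Theory.
Local Open Scope ring_scope.
Local Open Scope quotient_scope.
Local Open Scope classical_set_scope.

(* A bimodule over a K-algebra B: the actions of K through the left and the
   right action of B are required to agree, so that the bimodule is a K-vector
   space with k . v = k%:A *: v. *)
HB.mixin Record Lmodule_isBimodule (K : fieldType) (B : algType K) V
    of GRing.Lmodule B V := {
  rscale : V -> B -> V;
  rscaleDl : forall u v b, rscale (u + v) b = rscale u b + rscale v b;
  rscaleDr : forall v a b, rscale v (a + b) = rscale v a + rscale v b;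
  rscaleA : forall v a b, rscale (rscale v a) b = rscale v (a * b);
  rscaler1 : forall v, rscale v 1 = v;
  rscaleAl : forall a v b, rscale (a *: v) b = a *: rscale v b;
  rscale_central : forall (k : K) v, rscale v k%:A = k%:A *: v
}.

#[short(type="bimodType")]
HB.structure Definition Bimodule (K : fieldType) (B : algType K) :=
  {V of GRing.Lmodule B V & Lmodule_isBimodule K B V}.

Notation "v :* b" := (rscale v b) : ring_scope.

Section Tensor.
Context {K : fieldType} {B : algType K}.

(* Additive subgroups, as classical sets. *)
Definition subgroup (V : zmodType) (S : set V) :=
  S 0 /\ forall x y, S x -> S y -> S (x - y).

Section Def.
Variables (M : bimodType B) (N : lmodType B).

Local Notation F := {freeg (M * N)%type / int}.
Local Notation gen m n := (<< (m, n) >> : F).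

Definition tensor_rels : set F :=
  [set z | exists m m' n, z = gen (m + m') n - gen m n - gen m' n] `|`
  [set z | exists m n n', z = gen m (n + n') - gen m n - gen m n'] `|`
  [set z | exists m b n, z = gen (m :* b) n - gen m (b *: n)].

Definition tensor_ker : {pred F} :=
  fun x => `[< smallest (@subgroup F) tensor_rels x >].

Lemma tensor_ker_zmod_closed : zmod_closed tensor_ker.
Proof.
split; first by apply/asboolP => S [[S0 _] _].
move=> x y /asboolP xS /asboolP yS; apply/asboolP => S hS.
by case: (hS) => -[_ SB] _; apply: SB; [apply: xS|apply: yS].
Qed.

HB.instance Definition _ :=
  GRing.isZmodClosed.Build F tensor_ker tensor_ker_zmod_closed.

(* M ⊗_B N: the free abelian group on M * N modulo the subgroup generated by
   the biadditivity and B-balancedness relations. *)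
Definition tensor : Type := Quotient.quot tensor_ker.
HB.instance Definition _ := Choice.on tensor.
HB.instance Definition _ := GRing.Zmodule.on tensor.

Definition tens (m : M) (n : N) : tensor := \pi_(Quotient.quot tensor_ker) (gen m n).

Definition balanced (V : zmodType) (f : M -> N -> V) :=
  [/\ forall m m' n, f (m + m') n = f m n + f m' n,
      forall m n n', f m (n + n') = f m n + f m n' &
      forall m b n, f (m :* b) n = f m (b *: n)].

(* The additive map sending m ⊗ n to f m n; junk unless f is balanced. *)
Definition tensor_lift (V : zmodType) (f : M -> N -> V) (t : tensor) : V :=
  let z := repr t : F in \sum_(p <- dom z) f p.1 p.2 *~ coeff p z.

Lemma pi_is_additive : zmod_morphism (\pi_(Quotient.quot tensor_ker) : F -> tensor).
Proof. by move=> x y; rewrite !piE. Qed.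

Lemma pi_eq0 (z : F) : tensor_ker z -> \pi_(Quotient.quot tensor_ker) z = 0 :> tensor.
Proof.
move=> h; have -> : (0 : tensor) = \pi_(Quotient.quot tensor_ker) 0 by rewrite !piE.
by apply/eqP; rewrite -Quotient.idealrBE subr0.
Qed.

Lemma tens_balanced : balanced tens.
Proof.
have key (z : F) : tensor_rels z -> tensor_ker z.
  by move=> h; apply/asboolP; apply: sub_gen_smallest.
have piB := pi_is_additive.
split=> [m m' n|m n n'|m b n]; apply/eqP; rewrite -subr_eq0.
- rewrite opprD addrA /tens -!piB; apply/eqP/pi_eq0/key; left; left.
  by exists m, m', n.
- rewrite opprD addrA /tens -!piB; apply/eqP/pi_eq0/key; left; right.
  by exists m, n, n'.
- rewrite /tens -!piB; apply/eqP/pi_eq0/key; right; by exists m, b, n.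
Qed.

Lemma tensDl m m' n : tens (m + m') n = tens m n + tens m' n.
Proof. by case: tens_balanced. Qed.
Lemma tensDr m n n' : tens m (n + n') = tens m n + tens m n'.
Proof. by case: tens_balanced. Qed.
Lemma tensA m b n : tens (m :* b) n = tens m (b *: n).
Proof. by case: tens_balanced. Qed.

Section Lift.
Variables (V : zmodType) (f : M -> N -> V).
Hypothesis f_bal : balanced f.

Let phi (z : F) : V := \sum_(p <- dom z) f p.1 p.2 *~ coeff p z.

Let psi : {additive F -> zmodule V} :=
  HB.pack (fglift (fun p => f p.1 p.2 : zmodule V))
    (GRing.isZmodMorphism.Build F (zmodule V) _
      (lift_is_additive (fun p => f p.1 p.2 : zmodule V))).

Let psiU c p : psi << c *g p >> = f p.1 p.2 *~ c.
Proof. exact: liftU. Qed.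

Let phiE z : phi z = psi z.
Proof.
rewrite -[in RHS](freeg_sumE z) raddf_sum.
by apply: eq_bigr => p _; rewrite psiU.
Qed.

Let phiB : zmod_morphism phi.
Proof. by move=> x y; rewrite !phiE raddfB. Qed.

Let phiU m n : phi (gen m n) = f m n.
Proof. by rewrite phiE psiU. Qed.

Let phi_ker z : tensor_ker z -> phi z = 0.
Proof.
case: f_bal => fDl fDr fA.
move=> /asboolP /(_ [set z | phi z = 0]); apply; split.
  split=> [|x y] /=; first by have := phiB 0 0; rewrite !subrr.
  by move=> hx hy; rewrite phiB hx hy subrr.
move=> x /= [[[m [m' [n ->]]]|[m [n [n' ->]]]]|[m [b [n ->]]]].
- by rewrite !phiB !phiU fDl addrAC addrK subrr.
- by rewrite !phiB !phiU fDr addrAC addrK subrr.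
- by rewrite !phiB !phiU fA subrr.
Qed.

Let lift_pi z : tensor_lift f (\pi_(Quotient.quot tensor_ker) z) = phi z.
Proof.
apply/eqP; rewrite -subr_eq0 -[tensor_lift f _]/(phi (repr _)) -phiB.
by apply/eqP/phi_ker; rewrite -[is_true _]/(is_true (_ \in tensor_ker))
  Quotient.idealrBE reprK.
Qed.

Lemma tensor_lift_tens m n : tensor_lift f (tens m n) = f m n.
Proof. by rewrite lift_pi phiU. Qed.

Lemma tensor_lift_is_zmod_morphism : zmod_morphism (tensor_lift f).
Proof.
move=> x y; have piB := pi_is_additive.
rewrite -[x in LHS]reprK -[y in LHS]reprK -[X in tensor_lift f X]piB lift_pi.
by rewrite phiB.
Qed.

End Lift.

Lemma tensor_ind (P : tensor -> Prop) :
  P 0 -> (forall t u, P t -> P u -> P (t - u)) -> (forall m n, P (tens m n)) ->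
  forall t, P t.
Proof.
move=> P0 PB PT t; rewrite -[t]reprK; move: (repr t) => z.
have piB := pi_is_additive.
have PN u : P u -> P (- u) by move=> hu; rewrite -[- u]add0r; exact: PB.
have PD u v : P u -> P v -> P (u + v).
  by move=> hu hv; rewrite -[v]opprK; apply: PB => //; exact: PN.
pose g : {additive F -> tensor} :=
  HB.pack (\pi_(Quotient.quot tensor_ker) : F -> tensor)
    (GRing.isZmodMorphism.Build F tensor _ piB).
rewrite -[\pi_ _ z]/(g z) -(freeg_sumE z) raddf_sum /=.
elim/big_ind: _ => // -[m n] _; set c := coeff _ _.
have -> : << c *g (m, n) >> = gen m n *~ c.
  by rewrite freegU_mulz intz.
rewrite raddfMz; have Pn k : P (g (gen m n) *+ k).
  by elim: k => [|k IH]; rewrite ?mulr0n // mulrS; apply: PD => //; exact: PT.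
by case: c => k; [exact: Pn | rewrite NegzE mulrNz; apply: PN; exact: Pn].
Qed.

Lemma tensor_ext (V : zmodType) (f g : tensor -> V) :
  zmod_morphism f -> zmod_morphism g ->
  (forall m n, f (tens m n) = g (tens m n)) -> f =1 g.
Proof.
move=> fB gB fg; apply: tensor_ind => // [|t u ht hu].
  by have := fB 0 0; have := gB 0 0; rewrite !subrr => -> ->.
by rewrite fB gB ht hu.
Qed.

Definition tensor_scale (b : B) : tensor -> tensor :=
  tensor_lift (fun m n => tens (b *: m) n).

Let scale_bal b : balanced (fun m n => tens (b *: m) n).
Proof.
split=> [m m' n|m n n'|m a n]; first by rewrite scalerDr tensDl.
  by rewrite tensDr.
by rewrite -rscaleAl tensA.
Qed.

Lemma tensor_scale_tens b m n : tensor_scale b (tens m n) = tens (b *: m) n.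
Proof. exact/tensor_lift_tens/scale_bal. Qed.

Let scaleB b : zmod_morphism (tensor_scale b).
Proof. exact/tensor_lift_is_zmod_morphism/scale_bal. Qed.

Lemma tensor_scaleA a b t :
  tensor_scale a (tensor_scale b t) = tensor_scale (a * b) t.
Proof.
move: t; apply: tensor_ext => [x y|x y|m n]; rewrite ?scaleB //.
by rewrite !tensor_scale_tens scalerA.
Qed.

Lemma tensor_scale1 : left_id 1 tensor_scale.
Proof.
apply: tensor_ext => [x y|x y|m n]; rewrite ?scaleB //.
by rewrite tensor_scale_tens scale1r.
Qed.

Lemma tensor_scaleDr : right_distributive tensor_scale +%R.
Proof.
move=> b x y; rewrite -[y in LHS]opprK scaleB; congr (_ + _).
by rewrite -[- y]sub0r scaleB; have := scaleB b 0 0; rewrite !subrr => ->;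
   rewrite sub0r opprK.
Qed.

Lemma tensor_scaleDl t : {morph tensor_scale^~ t : a b / a + b}.
Proof.
move=> a b; move: t; apply: tensor_ext => [x y|x y|m n].
- by rewrite scaleB.
- by rewrite !scaleB opprD addrACA.
- by rewrite !tensor_scale_tens scalerDl tensDl.
Qed.

HB.instance Definition _ := GRing.Zmodule_isLmodule.Build B tensor
  tensor_scaleA tensor_scale1 tensor_scaleDr tensor_scaleDl.

Lemma scale_tens b m n : b *: tens m n = tens (b *: m) n.
Proof. exact: tensor_scale_tens. Qed.

End Def.

Section Bimod.
Variables M N : bimodType B.
Local Notation T := (tensor M N).

Definition tensor_rscale (t : T) (b : B) : T :=
  tensor_lift (fun m n => tens m (n :* b)) t.

Let rscale_bal b : balanced (fun (m : M) (n : N) => tens m (n :* b)).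
Proof.
split=> [m m' n|m n n'|m a n]; first by rewrite tensDl.
  by rewrite rscaleDl tensDr.
by rewrite tensA rscaleAl.
Qed.

Lemma tensor_rscale_tens m n b : tensor_rscale (tens m n) b = tens m (n :* b).
Proof. exact/tensor_lift_tens/rscale_bal. Qed.

Let rscaleB b : zmod_morphism (tensor_rscale^~ b).
Proof. exact/tensor_lift_is_zmod_morphism/rscale_bal. Qed.

Lemma tensor_rscaleDl u v b :
  tensor_rscale (u + v) b = tensor_rscale u b + tensor_rscale v b.
Proof.
have h := rscaleB b; rewrite -[v in LHS]opprK h; congr (_ + _).
by rewrite -[- v]sub0r h; have := h 0 0; rewrite !subrr => ->; rewrite sub0r opprK.
Qed.

Lemma tensor_rscaleDr t a b :
  tensor_rscale t (a + b) = tensor_rscale t a + tensor_rscale t b.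
Proof.
move: t; apply: tensor_ext => [x y|x y|m n].
- exact: rscaleB.
- by rewrite !rscaleB opprD addrACA.
- by rewrite !tensor_rscale_tens rscaleDr tensDr.
Qed.

Lemma tensor_rscaleA t a b :
  tensor_rscale (tensor_rscale t a) b = tensor_rscale t (a * b).
Proof.
move: t; apply: tensor_ext => [x y|x y|m n]; rewrite ?rscaleB //.
by rewrite !tensor_rscale_tens rscaleA.
Qed.

Lemma tensor_rscaler1 t : tensor_rscale t 1 = t.
Proof.
move: t; apply: tensor_ext => [x y|x y|m n]; rewrite ?rscaleB //.
by rewrite tensor_rscale_tens rscaler1.
Qed.

Lemma tensor_rscaleAl a t b : tensor_rscale (a *: t) b = a *: tensor_rscale t b.
Proof.
move: t; apply: tensor_ext => [x y|x y|m n]; rewrite ?scalerBr ?rscaleB ?scalerBr //.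
by rewrite scale_tens !tensor_rscale_tens scale_tens.
Qed.

Lemma tensor_rscale_central (k : K) t : tensor_rscale t k%:A = k%:A *: t.
Proof.
move: t; apply: tensor_ext => [x y|x y|m n]; rewrite ?rscaleB ?scalerBr //.
by rewrite tensor_rscale_tens scale_tens rscale_central -tensA rscale_central.
Qed.

HB.instance Definition _ := Lmodule_isBimodule.Build K B T
  tensor_rscaleDl tensor_rscaleDr tensor_rscaleA tensor_rscaler1
  tensor_rscaleAl tensor_rscale_central.

Lemma rscale_tens m n b : (tens m n : T) :* b = tens m (n :* b).
Proof. exact: tensor_rscale_tens. Qed.

End Bimod.
End Tensor.

Notation "M ⊗ N" := (tensor M N) (at level 40, left associativity) : type_scope.
Notation "m ⊗ n" := (tens m n) (at level 40, left associativity) : ring_scope.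

Section Calculus.
Context {K : fieldType}.

Definition subspace (V : lmodType K) (S : set V) :=
  S 0 /\ forall (k : K) u v, S u -> S v -> S (k *: u + v).

Definition subalgebra (A : algType K) (S : set A) :=
  [/\ subspace S, S 1 & forall x y, S x -> S y -> S (x * y)].

(* Differential graded algebras, with an internal grading: dga_gr n is the
   homogeneous part of degree n of the underlying algebra. *)
Record dga := Dga {
  dga_alg :> algType K;
  dga_gr : nat -> set dga_alg;
  dga_d : dga_alg -> dga_alg;
  dga_gr_subspace : forall n, subspace (dga_gr n);
  dga_gr_span : forall x, exists n (f : nat -> dga_alg),
    (forall i, dga_gr i (f i)) /\ x = \sum_(i < n) f i;
  dga_gr_direct : forall n (f : nat -> dga_alg),
    (forall i, dga_gr i (f i)) -> \sum_(i < n) f i = 0 ->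
    forall i, (i < n)%N -> f i = 0;
  dga_gr1 : dga_gr 0 1;
  dga_grM : forall m n x y, dga_gr m x -> dga_gr n y -> dga_gr (m + n) (x * y);
  dga_d_linear : linear dga_d;
  dga_d_gr : forall n x, dga_gr n x -> dga_gr n.+1 (dga_d x);
  dga_dd : forall x, dga_d (dga_d x) = 0;
  dga_leibniz : forall n x y, dga_gr n x ->
    dga_d (x * y) = dga_d x * y + (-1) ^+ n * (x * dga_d y)
}.

Arguments dga_gr : clear implicits.

Context (B : algType K).

Record fodc := Fodc {
  fodc_mod :> bimodType B;
  fodc_d : B -> fodc_mod;
  fodc_d_linear : forall (k : K) a b,
    fodc_d (k *: a + b) = k%:A *: fodc_d a + fodc_d b;
  fodc_leibniz : forall a b, fodc_d (a * b) = fodc_d a :* b + a *: fodc_d b;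
  fodc_gen : forall w, exists n (a b : 'I_n -> B),
    w = \sum_(i < n) a i *: fodc_d (b i)
}.

Arguments fodc_d : clear implicits.

(* Differential calculi over B; dc_incl identifies B with the degree zero
   part. *)
Record dc := Dc {
  dc_dga :> dga;
  dc_incl : {lrmorphism B -> dc_dga};
  dc_incl_inj : injective dc_incl;
  dc_incl_range : range dc_incl = dga_gr dc_dga 0;
  dc_gen : smallest (@subalgebra dc_dga)
    (range dc_incl `|` range (fun b => dga_d (dc_incl b))) = setT
}.

Arguments dc_incl : clear implicits.

(* Differential calculi extending the fodc W; dc_form identifies W with the
   degree one part. It is determined by its compatibility with d, as W is
   generated by the elements d b. *)
Record dc_ext (W : fodc) := DcExt {
  dc_ext_dc :> dc;
  dc_form : W -> dc_ext_dc;
  dc_formD : forall v w, dc_form (v + w) = dc_form v + dc_form w;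
  dc_formZl : forall b w, dc_form (b *: w) = dc_incl dc_ext_dc b * dc_form w;
  dc_formZr : forall w b, dc_form (w :* b) = dc_form w * dc_incl dc_ext_dc b;
  dc_form_inj : injective dc_form;
  dc_form_range : range dc_form = dga_gr dc_ext_dc 1;
  dc_form_d : forall b, dc_form (fodc_d W b) = dga_d (dc_incl dc_ext_dc b)
}.

Arguments dc_form {W} E w : rename.

(* Differential maps between differential calculi over B are morphisms of
   differential graded algebras which are the identity on B. *)
Definition differential_map (E E' : dc) (f : {lrmorphism E -> E'}) :=
  [/\ forall n x, dga_gr E n x -> dga_gr E' n (f x),
      forall x, f (dga_d x) = dga_d (f x) &
      forall b, f (dc_incl E b) = dc_incl E' b].

Definition maximal_prolongation (W : fodc) (E : dc_ext W) :=
  forall E' : dc_ext W, exists f : {lrmorphism E -> E'},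
    [/\ differential_map f, forall y, exists x, f x = y &
        forall g : {lrmorphism E -> E'}, differential_map g -> g =1 f].

Section Wedge.
Variables (W : fodc) (E : dc_ext W).

Lemma wedge_balanced :
  balanced (fun v w : W => dc_form E v * dc_form E w).
Proof.
split=> [u v w|u v w|v b w]; first by rewrite dc_formD mulrDl.
  by rewrite dc_formD mulrDr.
by rewrite dc_formZl dc_formZr mulrA.
Qed.

Definition wedge : (W ⊗ W)%type -> E :=
  tensor_lift (fun v w : W => dc_form E v * dc_form E w).

Lemma wedge_tens v w : wedge (v ⊗ w) = dc_form E v * dc_form E w.
Proof. exact/tensor_lift_tens/wedge_balanced. Qed.

Definition degree_two_relations : set (W ⊗ W)%type := [set t | wedge t = 0].

Definition torsion (nabla : W -> (W ⊗ W)%type) (w : W) : E :=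
  wedge (nabla w) - dga_d (dc_form E w).

Definition torsion_free (nabla : W -> (W ⊗ W)%type) :=
  forall w, torsion nabla w = 0.
End Wedge.

Definition bimodule_map (M N : bimodType B) (s : M -> N) :=
  [/\ forall u v, s (u + v) = s u + s v,
      forall b u, s (b *: u) = b *: s u &
      forall u b, s (u :* b) = s u :* b].

Definition connection (W : fodc) (F : lmodType B) (nabla : F -> (W ⊗ F)%type) :=
  (forall (k : K) u v, nabla (k%:A *: u + v) = k%:A *: nabla u + nabla v) /\
  (forall b u, nabla (b *: u) = fodc_d W b ⊗ u + b *: nabla u).

(* nabla is a bimodule connection with associated bimodule map sigma. *)
Definition bimodule_connection (W : fodc) (F : bimodType B)
    (nabla : F -> (W ⊗ F)%type) (sigma : (F ⊗ W)%type -> (W ⊗ F)%type) :=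
  [/\ connection nabla, bimodule_map sigma &
      forall u b, nabla (u :* b) = nabla u :* b + sigma (u ⊗ fodc_d W b)].

Definition subbimodule (M : bimodType B) (S : set M) :=
  [/\ S 0, forall u v, S u -> S v -> S (u + v),
      forall b u, S u -> S (b *: u) & forall u b, S u -> S (u :* b)].

Definition bimodule_span (M : bimodType B) (G : set M) : set M :=
  smallest (@subbimodule M) G.

End Calculus.

(* Main.v *)
Require Import Defs.
From HB Require Import structures.
From mathcomp Require Import all_boot all_algebra.
From mathcomp Require Import generic_quotient ring_quotient.
From mathcomp Require Import boolp classical_sets reals.
From mathcomp Require Import complex.
Import GRing.Theory.
Local Open Scope ring_scope.
Local Open Scope classical_set_scope.

(** Let S be the bimodule spanned by G. That S consists of relations is a
    computation in Om: torsion-freeness says that wedge o nabla = d on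
    one-forms, so wedge (nabla (d b)) = d (d b) = 0, and comparing the
    Leibniz rule of d on a product w b with that of nabla shows that sigma
    is minus the identity after wedging, wedge o sigma = - wedge
    ([wedge_sigma]).

    Conversely, the universal property of the maximal prolongation bounds its
    relations from above by those of any other calculus extending Om1: a
    differential map is determined on one-forms, hence commutes with the wedge
    products ([maximal_prolongation_relations]). It therefore suffices to
    exhibit one extension whose relations in degree two are exactly S. The
    connection provides it: on
      B + Om1 + (Om1 (x) Om1) / S,
    with all products of degree three or more equal to zero, take for the
    differential of a one-form w the class of nabla w. The Leibniz rule on b w
    is the left Leibniz rule of nabla, the one on w b is the right Leibniz rule
    of nabla up to w (x) d b + sigma (w (x) d b), and d o d = 0 holds because
    nabla (d b) lies in S; so each of the two families of generators
    is exactly what makes one of the axioms hold ([trunc_ext],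
    [trunc_relations]). *)

(** * Vanishing rules *)

Section BimoduleZero.
Context {K : fieldType} {B : algType K}.

Lemma rscale0l (V : bimodType B) (b : B) : (0 : V) :* b = 0.
Proof. by apply: (addrI (0 :* b)); rewrite -rscaleDl !addr0. Qed.

Lemma rscale0r (V : bimodType B) (v : V) : v :* (0 : B) = 0.
Proof. by apply: (addrI (v :* 0)); rewrite -rscaleDr !addr0. Qed.

Lemma rscaleBl (V : bimodType B) (u v : V) (b : B) :
  (u - v) :* b = u :* b - v :* b.
Proof. by rewrite -scaleN1r rscaleDl rscaleAl scaleN1r. Qed.

Lemma tens0l (M : bimodType B) (N : lmodType B) (n : N) : (0 : M) ⊗ n = 0.
Proof. by apply: (addrI (0 ⊗ n)); rewrite -tensDl !addr0. Qed.

Lemma tens0r (M : bimodType B) (N : lmodType B) (m : M) : m ⊗ (0 : N) = 0.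
Proof. by apply: (addrI (m ⊗ 0)); rewrite -tensDr !addr0. Qed.

(** For products of homogeneous tuples, most of whose terms vanish. *)
Definition null_rules :=
  (@mul0r, @mulr0, @scale0r, @scaler0, @rscale0l, @rscale0r, @tens0l, @tens0r,
   @addr0, @add0r, @subr0, @oppr0).

End BimoduleZero.

(** * Quotient by a spanned sub-bimodule *)

Section SpanQuotient.
Set Implicit Arguments.
Unset Strict Implicit.
Context {K : fieldType} {B : algType K} (M : bimodType B) (G : set M).

Lemma bimodule_span_subbimodule : subbimodule (bimodule_span G).
Proof.
split=> [S [[]]//|u v hu hv S hS|b u hu S hS|u b hu S hS].
- by case: (hS) => -[_ SD _ _] _; apply: SD; [exact: hu|exact: hv].
- by case: (hS) => -[_ _ SZ _] _; apply: SZ; exact: hu.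
- by case: (hS) => -[_ _ _ SR] _; apply: SR; exact: hu.
Qed.

(** The span of G rather than a given sub-bimodule, so that the structures on
    the quotient can be inferred without a side condition. *)
Definition span_pred : {pred M} := fun x => `[< bimodule_span G x >].

Lemma span_predP x : reflect (bimodule_span G x) (x \in span_pred).
Proof. exact: asboolP. Qed.

Lemma span_pred_zmod_closed : zmod_closed span_pred.
Proof.
have [S0 SD SZ _] := bimodule_span_subbimodule.
split=> [|x y /span_predP hx /span_predP hy]; apply/span_predP => //.
by apply: SD => //; rewrite -scaleN1r; exact: SZ.
Qed.

HB.instance Definition _ :=
  GRing.isZmodClosed.Build M span_pred span_pred_zmod_closed.

Definition span_quot : Type := Quotient.quot span_pred.
HB.instance Definition _ := Choice.on span_quot.
HB.instance Definition _ := GRing.Zmodule.on span_quot.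

Definition cls (x : M) : span_quot := \pi_(Quotient.quot span_pred)%qT x.

Lemma cls_eq x y : cls x = cls y <-> bimodule_span G (x - y).
Proof.
split=> [h|/span_predP].
  by apply/span_predP; rewrite Quotient.idealrBE; apply/eqP.
by rewrite Quotient.idealrBE => /eqP.
Qed.

Lemma cls_eq0 x : cls x = 0 <-> bimodule_span G x.
Proof.
have -> : (0 : span_quot) = cls 0 by rewrite /cls !piE.
by rewrite cls_eq subr0.
Qed.

Lemma clsK (q : span_quot) : cls (repr q) = q.
Proof. exact: reprK. Qed.

Lemma cls_surj (q : span_quot) : exists x, q = cls x.
Proof. by exists (repr q); rewrite clsK. Qed.

Lemma cls_is_zmod_morphism : zmod_morphism cls.
Proof. by move=> x y; rewrite /cls !piE. Qed.

HB.instance Definition _ :=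
  GRing.isZmodMorphism.Build M span_quot cls cls_is_zmod_morphism.

Definition span_quot_scale (b : B) (q : span_quot) : span_quot :=
  cls (b *: repr q).
Definition span_quot_rscale (q : span_quot) (b : B) : span_quot :=
  cls (repr q :* b).

Lemma span_quot_scale_cls b x : span_quot_scale b (cls x) = cls (b *: x).
Proof.
have [_ _ SZ _] := bimodule_span_subbimodule.
by apply/cls_eq; rewrite -scalerBr; apply: SZ; apply/cls_eq; rewrite clsK.
Qed.

Lemma span_quot_rscale_cls x b : span_quot_rscale (cls x) b = cls (x :* b).
Proof.
have [_ _ _ SR] := bimodule_span_subbimodule.
by apply/cls_eq; rewrite -rscaleBl; apply: SR; apply/cls_eq; rewrite clsK.
Qed.

Fact span_quot_scaleA a b q :
  span_quot_scale a (span_quot_scale b q) = span_quot_scale (a * b) q.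
Proof. by have [x ->] := cls_surj q; rewrite !span_quot_scale_cls scalerA. Qed.

Fact span_quot_scale1 : left_id 1 span_quot_scale.
Proof.
by move=> q; have [x ->] := cls_surj q; rewrite span_quot_scale_cls scale1r.
Qed.

Fact span_quot_scaleDr : right_distributive span_quot_scale +%R.
Proof.
move=> b p q; have [x ->] := cls_surj p; have [y ->] := cls_surj q.
by rewrite -raddfD !span_quot_scale_cls scalerDr raddfD.
Qed.

Fact span_quot_scaleDl q : {morph span_quot_scale^~ q : a b / a + b}.
Proof.
move=> a b; have [x ->] := cls_surj q.
by rewrite !span_quot_scale_cls scalerDl raddfD.
Qed.

HB.instance Definition _ := GRing.Zmodule_isLmodule.Build B span_quot
  span_quot_scaleA span_quot_scale1 span_quot_scaleDr span_quot_scaleDl.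

Lemma cls_scale b x : cls (b *: x) = b *: cls x.
Proof. by rewrite -span_quot_scale_cls. Qed.

Fact span_quot_rscaleDl p q b :
  span_quot_rscale (p + q) b = span_quot_rscale p b + span_quot_rscale q b.
Proof.
have [x ->] := cls_surj p; have [y ->] := cls_surj q.
by rewrite -raddfD !span_quot_rscale_cls rscaleDl raddfD.
Qed.

Fact span_quot_rscaleDr q a b :
  span_quot_rscale q (a + b) = span_quot_rscale q a + span_quot_rscale q b.
Proof.
by have [x ->] := cls_surj q; rewrite !span_quot_rscale_cls rscaleDr raddfD.
Qed.

Fact span_quot_rscaleA q a b :
  span_quot_rscale (span_quot_rscale q a) b = span_quot_rscale q (a * b).
Proof. by have [x ->] := cls_surj q; rewrite !span_quot_rscale_cls rscaleA. Qed.

Fact span_quot_rscaler1 q : span_quot_rscale q 1 = q.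
Proof. by have [x ->] := cls_surj q; rewrite span_quot_rscale_cls rscaler1. Qed.

Fact span_quot_rscaleAl a q b :
  span_quot_rscale (a *: q) b = a *: span_quot_rscale q b.
Proof.
have [x ->] := cls_surj q.
by rewrite -cls_scale !span_quot_rscale_cls rscaleAl cls_scale.
Qed.

Fact span_quot_rscale_central (k : K) q : span_quot_rscale q k%:A = k%:A *: q.
Proof.
have [x ->] := cls_surj q.
by rewrite span_quot_rscale_cls rscale_central cls_scale.
Qed.

HB.instance Definition _ := Lmodule_isBimodule.Build K B span_quot
  span_quot_rscaleDl span_quot_rscaleDr span_quot_rscaleA span_quot_rscaler1
  span_quot_rscaleAl span_quot_rscale_central.

Lemma cls_rscale x b : cls (x :* b) = cls x :* b.
Proof. by rewrite -span_quot_rscale_cls. Qed.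

End SpanQuotient.

(** * The truncated quadratic algebra *)

Section Truncation.
Set Implicit Arguments.
Unset Strict Implicit.
Context {K : fieldType} {B : algType K} {W : bimodType B}.
Context {G : set (W ⊗ W)%type}.
Local Notation Q := (span_quot G).

(** The algebra B + W + (W ⊗ W) / span G, graded in degrees 0, 1 and 2: the
    tensor algebra of W modulo G in degree two and modulo everything above. *)
Definition trunc : Type := (B * W * Q)%type.
HB.instance Definition _ := GRing.Zmodule.copy trunc (B * W * Q)%type.

Lemma trunc_eq (x y : trunc) :
  x.1.1 = y.1.1 -> x.1.2 = y.1.2 -> x.2 = y.2 -> x = y.
Proof. by move: x y => [[a v] p] [[b w] q] /= -> -> ->. Qed.

Definition trunc_one : trunc := (1, 0, 0).
Definition trunc_mul (x y : trunc) : trunc :=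
  (x.1.1 * y.1.1,
   x.1.1 *: y.1.2 + x.1.2 :* y.1.1,
   x.1.1 *: y.2 + cls G (x.1.2 ⊗ y.1.2) + x.2 :* y.1.1).

Fact trunc_mulA : associative trunc_mul.
Proof.
move=> [[a v] p] [[b w] q] [[c u] r]; apply: trunc_eq => /=; first exact: mulrA.
  by rewrite scalerDr rscaleDl scalerA rscaleA rscaleAl addrA.
rewrite !scalerDr !rscaleDl tensDr tensDl !raddfD /= scalerA rscaleA rscaleAl.
rewrite -scale_tens cls_scale -rscale_tens cls_rscale tensA.
by rewrite -!addrA; congr (_ + (_ + _)); rewrite addrCA.
Qed.

Fact trunc_mul1r : left_id trunc_one trunc_mul.
Proof.
move=> [[a v] p]; rewrite /trunc_mul /=.
by rewrite mul1r !scale1r !rscale0l tens0l raddf0 !addr0.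
Qed.

Fact trunc_mulr1 : right_id trunc_one trunc_mul.
Proof.
move=> [[a v] p]; rewrite /trunc_mul /=.
by rewrite mulr1 !rscaler1 !scaler0 tens0r raddf0 !add0r.
Qed.

Fact trunc_mulDl : left_distributive trunc_mul +%R.
Proof.
move=> [[a v] p] [[b w] q] [[c u] r]; apply: trunc_eq => /=.
- exact: mulrDl.
- by rewrite scalerDl rscaleDl addrACA.
- rewrite scalerDl rscaleDl tensDl raddfD /=.
  by rewrite [RHS]addrACA; congr (_ + _); rewrite addrACA.
Qed.

Fact trunc_mulDr : right_distributive trunc_mul +%R.
Proof.
move=> [[a v] p] [[b w] q] [[c u] r]; apply: trunc_eq => /=.
- exact: mulrDr.
- by rewrite scalerDr rscaleDr addrACA.
- rewrite scalerDr rscaleDr tensDr raddfD /=.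
  by rewrite [RHS]addrACA; congr (_ + _); rewrite addrACA.
Qed.

Fact trunc_one_neq0 : trunc_one != 0.
Proof. by apply/eqP => -[/eqP]; rewrite oner_eq0. Qed.

HB.instance Definition _ := GRing.Zmodule_isNzRing.Build trunc
  trunc_mulA trunc_mul1r trunc_mulr1 trunc_mulDl trunc_mulDr trunc_one_neq0.

(** K acts on W and on the quotient through its image in B. *)
Definition trunc_scale (k : K) (x : trunc) : trunc :=
  (k *: x.1.1, (k%:A : B) *: x.1.2, (k%:A : B) *: x.2).

Fact trunc_scaleA j k x :
  trunc_scale j (trunc_scale k x) = trunc_scale (j * k) x.
Proof.
by rewrite /trunc_scale /= !scalerA -scalerAl mul1r scalerA.
Qed.

Fact trunc_scale1 : left_id 1 trunc_scale.
Proof. by move=> [[a v] p]; rewrite /trunc_scale /= !scale1r. Qed.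

Fact trunc_scaleDr : right_distributive trunc_scale +%R.
Proof. by move=> k [[a v] p] [[b w] q]; rewrite /trunc_scale /= !scalerDr. Qed.

Fact trunc_scaleDl x : {morph trunc_scale^~ x : j k / j + k}.
Proof. by move=> j k; rewrite /trunc_scale /= !scalerDl. Qed.

HB.instance Definition _ := GRing.Zmodule_isLmodule.Build K trunc
  trunc_scaleA trunc_scale1 trunc_scaleDr trunc_scaleDl.

Fact trunc_scalerAl k (x y : trunc) : k *: (x * y) = (k *: x) * y.
Proof.
move: x y => [[a v] p] [[b w] q]; apply: trunc_eq => /=.
- exact: scalerAl.
- by rewrite scalerDr scalerA mulr_algl rscaleAl.
- by rewrite !scalerDr scalerA mulr_algl rscaleAl -scale_tens cls_scale.
Qed.

HB.instance Definition _ :=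
  GRing.Lmodule_isLalgebra.Build K trunc trunc_scalerAl.

Fact trunc_scalerAr k (x y : trunc) : k *: (x * y) = x * (k *: y).
Proof.
have kA (V : bimodType B) (v : V) (b : B) : v :* (k *: b) = k%:A *: (v :* b).
  by rewrite -(mulr_algl k b) -rscaleA rscale_central rscaleAl.
have Ak (V : bimodType B) (v : V) (b : B) : b *: (k%:A *: v) = k%:A *: (b *: v).
  by rewrite !scalerA mulr_algl mulr_algr.
move: x y => [[a v] p] [[b w] q]; apply: trunc_eq => /=.
- exact: scalerAr.
- by rewrite scalerDr kA Ak.
- by rewrite !scalerDr kA Ak -tensA rscale_central -scale_tens cls_scale.
Qed.

HB.instance Definition _ :=
  GRing.Lalgebra_isAlgebra.Build K trunc trunc_scalerAr.

Lemma cls0 : cls G 0 = 0.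
Proof. exact: raddf0. Qed.

Let nullE := (@null_rules K B, cls0).

Definition trunc_incl (b : B) : trunc := (b, 0, 0).
Definition trunc_form (w : W) : trunc := (0, w, 0).
Definition trunc_top (q : Q) : trunc := (0, 0, q).

Definition trunc_proj (n : nat) (x : trunc) : trunc :=
  match n with
  | 0 => trunc_incl x.1.1
  | 1 => trunc_form x.1.2
  | 2 => trunc_top x.2
  | _ => 0
  end.

(** Membership as a fixed point of the projection, so that a homogeneous
    element can be replaced by an explicit tuple. *)
Definition trunc_gr (n : nat) : set trunc := [set x | trunc_proj n x = x].

Lemma trunc_proj_linear n : linear (trunc_proj n).
Proof.
move=> k x y; case: n => [|[|[|n]]]; apply: trunc_eq => //=;
  by rewrite ?scaler0 ?addr0.
Qed.

Lemma trunc_proj_proj m n x :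
  trunc_proj m (trunc_proj n x) = if m == n then trunc_proj n x else 0.
Proof. by case: m => [|[|[|m]]]; case: n => [|[|[|n]]] //=; case: eqP. Qed.

Lemma trunc_proj_sum x : x = \sum_(i < 3) trunc_proj i x.
Proof.
rewrite !big_ord_recl big_ord0 addr0; apply: trunc_eq;
  by rewrite /= ?addr0 ?add0r.
Qed.

Fact trunc_gr_subspace n : subspace (trunc_gr n).
Proof.
have lin := trunc_proj_linear n; split=> [|k u v hu hv]; rewrite /trunc_gr /=.
  by case: n {lin} => [|[|[|n]]].
by rewrite lin hu hv.
Qed.

Fact trunc_gr_span x : exists n (f : nat -> trunc),
  (forall i, trunc_gr i (f i)) /\ x = \sum_(i < n) f i.
Proof.
exists 3, (trunc_proj^~ x); split; last exact: trunc_proj_sum.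
by move=> i; rewrite /trunc_gr /= trunc_proj_proj eqxx.
Qed.

Fact trunc_gr_direct n (f : nat -> trunc) : (forall i, trunc_gr i (f i)) ->
  \sum_(i < n) f i = 0 -> forall i, (i < n)%N -> f i = 0.
Proof.
move=> hf sum0 i lt_in.
have projD : {morph trunc_proj i : x y / x + y}.
  by move=> x y; have := trunc_proj_linear i 1 x y; rewrite !scale1r.
have proj0 : trunc_proj i 0 = 0 by case: i {lt_in projD} => [|[|[|i]]].
have := congr1 (trunc_proj i) sum0.
rewrite (big_morph _ projD proj0) proj0 (bigD1 (Ordinal lt_in)) //= hf.
rewrite big1 ?addr0 // => j ne_ji; rewrite -(hf j) trunc_proj_proj.
by case: eqP => // eij; case/eqP: ne_ji; apply: val_inj.
Qed.

Fact trunc_gr1 : trunc_gr 0 1.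
Proof. by []. Qed.

Fact trunc_grM m n x y :
  trunc_gr m x -> trunc_gr n y -> trunc_gr (m + n) (x * y).
Proof.
rewrite /trunc_gr /= => <- <-.
by case: m => [|[|[|m]]]; case: n => [|[|[|n]]] //=; rewrite ?mul0r ?mulr0 //;
  apply: trunc_eq; rewrite /= ?nullE.
Qed.

Fact trunc_incl_zmod_morphism : zmod_morphism trunc_incl.
Proof. by move=> a b; apply: trunc_eq; rewrite /= ?nullE. Qed.

Fact trunc_incl_monoid_morphism : monoid_morphism trunc_incl.
Proof. by split=> // a b; apply: trunc_eq; rewrite /= ?nullE. Qed.

Fact trunc_incl_scalable : scalable trunc_incl.
Proof. by move=> k b; apply: trunc_eq; rewrite //= scaler0. Qed.

HB.instance Definition _ :=
  GRing.isZmodMorphism.Build B trunc trunc_incl trunc_incl_zmod_morphism.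
HB.instance Definition _ :=
  GRing.isMonoidMorphism.Build B trunc trunc_incl trunc_incl_monoid_morphism.
HB.instance Definition _ :=
  GRing.isScalable.Build K B trunc *:%R trunc_incl trunc_incl_scalable.

Lemma trunc_incl_inj : injective trunc_incl.
Proof. by move=> a b /(congr1 (fun x : trunc => x.1.1)). Qed.

Lemma trunc_incl_range : range trunc_incl = trunc_gr 0.
Proof.
apply/seteqP; split=> [_ [b _ <-] //|x <-].
by exists x.1.1.
Qed.

Lemma trunc_formM v w :
  trunc_form v * trunc_form w = trunc_top (cls G (v ⊗ w)).
Proof. by apply: trunc_eq; rewrite /= ?nullE. Qed.

Lemma trunc_top_is_zmod_morphism : zmod_morphism trunc_top.
Proof. by move=> p q; apply: trunc_eq; rewrite /= ?nullE. Qed.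

HB.instance Definition _ :=
  GRing.isZmodMorphism.Build Q trunc trunc_top trunc_top_is_zmod_morphism.

Lemma trunc_formD v w : trunc_form (v + w) = trunc_form v + trunc_form w.
Proof. by apply: trunc_eq; rewrite /= ?nullE. Qed.

Lemma trunc_formZl b w : trunc_form (b *: w) = trunc_incl b * trunc_form w.
Proof. by apply: trunc_eq; rewrite /= ?nullE. Qed.

Lemma trunc_formZr w b : trunc_form (w :* b) = trunc_form w * trunc_incl b.
Proof. by apply: trunc_eq; rewrite /= ?nullE. Qed.

Lemma trunc_form_inj : injective trunc_form.
Proof. by move=> v w /(congr1 (fun x : trunc => x.1.2)). Qed.

Lemma trunc_form_range : range trunc_form = trunc_gr 1.
Proof.
apply/seteqP; split=> [_ [w _ <-] //|x <-].
by exists x.1.2.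
Qed.

End Truncation.

Arguments trunc {K B W} G.

(** * A calculus truncated above degree two *)

Section FodcDifferential.
Context {K : fieldType} {B : algType K} (W : fodc B).
Local Notation dB := (fodc_d W).

Lemma fodc_dD a b : dB (a + b) = dB a + dB b.
Proof. by have := fodc_d_linear W 1 a b; rewrite !scale1r. Qed.

Lemma fodc_d0 : dB 0 = 0.
Proof. by apply: (addrI (dB 0)); rewrite -fodc_dD !addr0. Qed.

End FodcDifferential.

Section Extension.
Set Implicit Arguments.
Unset Strict Implicit.
Context {K : fieldType} {B : algType K} (W : fodc B).
Variable G : set (W ⊗ W)%type.
Local Notation Q := (span_quot G).
Local Notation E := (trunc G).
Local Notation dB := (fodc_d W).

(** A prospective differential on one-forms; with D w the class of nabla w for
    a bimodule connection nabla, the first two hypotheses hold because nabla is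
    a connection, the third because G contains the tensors
    v ⊗ w + sigma (v ⊗ w), and the last because G contains the nabla (d b). *)
Variable D : W -> Q.
Hypothesis D_linear : forall (k : K) v w, D (k%:A *: v + w) = k%:A *: D v + D w.
Hypothesis D_scale : forall b w, D (b *: w) = cls G (dB b ⊗ w) + b *: D w.
Hypothesis D_rscale : forall w b, D (w :* b) = D w :* b - cls G (w ⊗ dB b).
Hypothesis D_exact : forall b, D (dB b) = 0.

Definition trunc_d (x : E) : E := (0, dB x.1.1, D x.1.2).

Let D0 : D 0 = 0.
Proof. by rewrite -fodc_d0 D_exact. Qed.

Let nullE := (fodc_d0 W, D0, @null_rules K B, @cls0 K B W G).

Fact trunc_d_linear : linear trunc_d.
Proof.
move=> k x y; apply: trunc_eq => /=; first by rewrite scaler0 addr0.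
  exact: fodc_d_linear.
exact: D_linear.
Qed.

Fact trunc_d_gr n x : trunc_gr n x -> trunc_gr n.+1 (trunc_d x).
Proof.
rewrite /trunc_gr /= => <-; case: n => [|[|[|n]]]; apply: trunc_eq => //=;
by rewrite ?fodc_d0 ?D0.
Qed.

Fact trunc_dd x : trunc_d (trunc_d x) = 0.
Proof. by apply: trunc_eq => //=; rewrite ?fodc_d0 ?D_exact. Qed.

Fact trunc_leibniz n x y : trunc_gr n x ->
  trunc_d (x * y) = trunc_d x * y + (-1) ^+ n * (x * trunc_d y).
Proof.
rewrite /trunc_gr /= => <-.
case: n => [|[|n]].
- rewrite expr0 mul1r; apply: trunc_eq; rewrite /= ?nullE //.
  exact: fodc_leibniz.
- by rewrite expr1 mulN1r; apply: trunc_eq; rewrite /= ?nullE.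
(* For x of degree two or more, every term has degree three or more, hence
   vanishes. *)
have -> : trunc_proj n.+2 x * trunc_d y = 0.
  by case: n => [|n]; apply: trunc_eq; rewrite /= ?nullE.
by rewrite mulr0 addr0; case: n => [|n]; apply: trunc_eq; rewrite /= ?nullE.
Qed.

Definition trunc_dga : dga := @Dga K E trunc_gr trunc_d trunc_gr_subspace
  trunc_gr_span trunc_gr_direct trunc_gr1 trunc_grM trunc_d_linear trunc_d_gr
  trunc_dd trunc_leibniz.

Lemma trunc_form_d b : trunc_form (dB b) = trunc_d (trunc_incl b).
Proof. by apply: trunc_eq; rewrite //= D0. Qed.

(** One-forms are sums of products a * d b, and the top degree is spanned by
    products of two one-forms, as W ⊗ W is spanned by pure tensors. *)
Lemma trunc_gen : smallest (@subalgebra K E)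
  (range trunc_incl `|` range (fun b => trunc_d (trunc_incl b))) = setT.
Proof.
apply/seteqP; split=> // x _ S [[[S0 SK] S1 SM] Ssub].
have SD u v : S u -> S v -> S (u + v).
  by move=> hu hv; rewrite -[u]scale1r; exact: SK.
have Sincl b : S (trunc_incl b) by apply: Ssub; left; exists b.
have Sform w : S (trunc_form w).
  have [n [a [b ->]]] := fodc_gen w.
  elim/big_ind: _ => // [u v hu hv|i _].
    by rewrite trunc_formD; apply: SD.
  rewrite trunc_formZl; apply: SM => //; rewrite trunc_form_d.
  by apply: Ssub; right; exists (b i).
have Stop t : S (trunc_top (cls G t)).
  move: t; apply: tensor_ind => [|t u ht hu|v w]; first by rewrite !raddf0.
    by rewrite !raddfB addrC -scaleN1r; exact: SK.
  by rewrite -trunc_formM; apply: SM.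
rewrite (trunc_proj_sum x) !big_ord_recl big_ord0 addr0.
have [t ht] := cls_surj x.2.
apply: (SD _ _ (Sincl x.1.1)); apply: (SD _ _ (Sform x.1.2)).
by rewrite /= ht.
Qed.

Definition trunc_dc : dc B := @Dc K B trunc_dga trunc_incl
  trunc_incl_inj trunc_incl_range trunc_gen.

Definition trunc_ext : dc_ext W := @DcExt K B W trunc_dc trunc_form
  trunc_formD trunc_formZl trunc_formZr trunc_form_inj trunc_form_range
  trunc_form_d.

Lemma trunc_wedge t : wedge trunc_ext t = trunc_top (cls G t).
Proof.
move: t; apply: tensor_ext => [||v w].
- exact/tensor_lift_is_zmod_morphism/wedge_balanced.
- by move=> t u; rewrite !raddfB.
- by rewrite wedge_tens; exact: trunc_formM.
Qed.

(** The purpose of the construction: imposing G makes nothing vanish in degree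
    two beyond its span, since the wedge product of [trunc_ext] is the quotient
    map. *)
Lemma trunc_relations : degree_two_relations trunc_ext = bimodule_span G.
Proof.
apply/seteqP; split=> t; rewrite /degree_two_relations /= trunc_wedge.
  by move=> [/cls_eq0].
by move/cls_eq0 => ->.
Qed.

End Extension.

(** * Relations of the maximal prolongation *)

Section Relations.
Set Implicit Arguments.
Unset Strict Implicit.
Context {K : fieldType} {B : algType K} (W : fodc B).

Lemma wedge_is_zmod_morphism (E : dc_ext W) : zmod_morphism (wedge E).
Proof. exact/tensor_lift_is_zmod_morphism/wedge_balanced. Qed.

HB.instance Definition _ (E : dc_ext W) :=
  GRing.isZmodMorphism.Build _ _ (wedge E) (wedge_is_zmod_morphism E).

Lemma wedge_scale (E : dc_ext W) b t :
  wedge E (b *: t) = dc_incl E b * wedge E t.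
Proof.
move: t; apply: tensor_ext => [t u|t u|v w].
- by rewrite scalerBr raddfB.
- by rewrite raddfB mulrBr.
- by rewrite scale_tens !wedge_tens dc_formZl mulrA.
Qed.

Lemma wedge_rscale (E : dc_ext W) t b :
  wedge E (t :* b) = wedge E t * dc_incl E b.
Proof.
move: t; apply: tensor_ext => [t u|t u|v w].
- by rewrite rscaleBl raddfB.
- by rewrite raddfB mulrBl.
- by rewrite rscale_tens !wedge_tens dc_formZr mulrA.
Qed.

Lemma degree_two_relations_subbimodule (E : dc_ext W) :
  subbimodule (degree_two_relations E).
Proof.
rewrite /degree_two_relations; split=> [|u v /= hu hv|b u /= hu|u b /= hu].
- exact: raddf0.
- by rewrite raddfD /= hu hv addr0.
- by rewrite wedge_scale hu mulr0.
- by rewrite wedge_rscale hu mul0r.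
Qed.

(** W is generated by B and d B, on which a differential map is prescribed. *)
Lemma differential_map_form (E E' : dc_ext W) (f : {lrmorphism E -> E'}) w :
  differential_map f -> f (dc_form E w) = dc_form E' w.
Proof.
move=> [_ fd fincl].
have form0 (F : dc_ext W) : dc_form F 0 = 0.
  by apply: (addrI (dc_form F 0)); rewrite -dc_formD !addr0.
have [n [a [b ->]]] := fodc_gen w.
rewrite !(big_morph _ (dc_formD _) (form0 _)) raddf_sum.
apply: eq_bigr => i _.
by rewrite /= !dc_formZl rmorphM /= fincl !dc_form_d fd fincl.
Qed.

Lemma differential_map_wedge (E E' : dc_ext W) (f : {lrmorphism E -> E'}) t :
  differential_map f -> f (wedge E t) = wedge E' t.
Proof.
move=> hf; move: t; apply: tensor_ext => [t u|t u|v w]; rewrite ?raddfB //.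
by rewrite !wedge_tens rmorphM /= !(differential_map_form _ hf).
Qed.

(** A relation that holds in the maximal prolongation is carried to every
    extension by the differential map onto it. *)
Lemma maximal_prolongation_relations (E E' : dc_ext W) :
  maximal_prolongation E -> degree_two_relations E `<=` degree_two_relations E'.
Proof.
move=> /(_ E') [f [hf _ _]] t; rewrite /degree_two_relations /= => ht.
by rewrite -(differential_map_wedge t hf) ht raddf0.
Qed.

End Relations.

(** * Torsion-free connections *)

Section TorsionFree.
Set Implicit Arguments.
Unset Strict Implicit.
Context {K : fieldType} {B : algType K} (W : fodc B) (E : dc_ext W).
Variables (nabla : W -> (W ⊗ W)%type)
  (sigma : (W ⊗ W)%type -> (W ⊗ W)%type).
Hypothesis nabla_conn : bimodule_connection nabla sigma.
Hypothesis nabla_tf : torsion_free E nabla.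

Lemma torsion_free_wedge w : wedge E (nabla w) = dga_d (dc_form E w).
Proof. by apply/eqP; rewrite -subr_eq0; apply/eqP/nabla_tf. Qed.

Lemma dc_form_gr w : @dga_gr _ E 1 (dc_form E w).
Proof. by rewrite -dc_form_range; exists w. Qed.

Lemma wedge_nabla_exact b : wedge E (nabla (fodc_d W b)) = 0.
Proof. by rewrite torsion_free_wedge dc_form_d dga_dd. Qed.

(** On u ⊗ d b, apply d = wedge o nabla to u b: the Leibniz rule of d gives the
    term - u * d b where that of nabla gives wedge (sigma (u ⊗ d b)). Moving
    coefficients of d b across the tensor sign reduces all tensors to these. *)
Lemma wedge_sigma t : wedge E (sigma t) = - wedge E t.
Proof.
have [_ [sD sZ sR] nablaR] := nabla_conn.
have sB : zmod_morphism sigma.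
  by move=> x y; rewrite sD -!scaleN1r sZ.
move: t; apply: tensor_ext => [t u|t u|v w].
- by rewrite sB raddfB.
- by rewrite raddfB opprD.
have exact_case u b :
    wedge E (sigma (u ⊗ fodc_d W b)) = - wedge E (u ⊗ fodc_d W b).
  have := torsion_free_wedge (u :* b).
  rewrite nablaR dc_formZr (dga_leibniz _ (dc_form_gr u)) raddfD /= wedge_rscale.
  rewrite torsion_free_wedge => /addrI ->.
  by rewrite expr1 mulN1r wedge_tens dc_form_d.
have tensD : {morph (fun y : W => v ⊗ y) : x y / x + y}.
  by move=> x y; exact: tensDr.
have [n [a [b ->]]] := fodc_gen w.
rewrite (big_morph _ tensD (tens0r _ _ _)).
have s0 : sigma 0 = 0 by have := sB 0 0; rewrite !subrr.
rewrite (big_morph _ sD s0) !(raddf_sum (wedge E)) -sumrN.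
by apply: eq_bigr => i _; rewrite -tensA; exact: exact_case.
Qed.

End TorsionFree.

Theorem theorem3p1 (R : realType) (B : algType R[i]) (Om1 : fodc B)
  (nabla : Om1 -> (Om1 ⊗ Om1)%type)
  (sigma : (Om1 ⊗ Om1)%type -> (Om1 ⊗ Om1)%type)
  (nabla_conn : bimodule_connection nabla sigma)
  (Om : dc_ext Om1) (Om_max : maximal_prolongation Om)
  (nabla_tf : torsion_free Om nabla) :
  degree_two_relations Om =
  bimodule_span
    ([set t | exists w v : Om1, t = w ⊗ v + sigma (w ⊗ v)] `|`
     [set t | exists b : B, t = nabla (fodc_d Om1 b)]).
Proof.
set G := _ `|` _; apply/seteqP; split; last first.
  apply: smallest_sub; first exact: degree_two_relations_subbimodule.
  move=> _ [[w [v ->]]|[b ->]]; rewrite /degree_two_relations /=.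
    by rewrite raddfD /= (wedge_sigma nabla_conn nabla_tf) subrr.
  exact: wedge_nabla_exact.
(* It remains to see that nabla induces the differential of an extension
   with relations spanned by G. *)
have [[nablaK nablaZ] _ nablaR] := nabla_conn.
pose D w := cls G (nabla w).
have clsG t : G t -> cls G t = 0.
  by move=> Gt; apply/cls_eq0; exact: sub_gen_smallest.
have D_linear (k : R[i]) v w : D (k%:A *: v + w) = k%:A *: D v + D w.
  by rewrite /D nablaK raddfD /= cls_scale.
have D_scale b w : D (b *: w) = cls G (fodc_d Om1 b ⊗ w) + b *: D w.
  by rewrite /D nablaZ raddfD /= cls_scale.
have D_rscale w b : D (w :* b) = D w :* b - cls G (w ⊗ fodc_d Om1 b).
  rewrite /D nablaR raddfD /= cls_rscale; congr (_ + _).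
  (* w ⊗ d b + sigma (w ⊗ d b) belongs to G, so the two classes are
     opposite. *)
  apply/eqP; rewrite -addr_eq0 addrC -raddfD; apply/eqP/clsG.
  by left; exists w, (fodc_d Om1 b).
have D_exact b : D (fodc_d Om1 b) = 0 by apply: clsG; right; exists b.
rewrite -(trunc_relations D_linear D_scale D_rscale D_exact).
exact: maximal_prolongation_relations.
Qed.
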